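(* Let $Q$ be an automorphic loop and $x,y\in Q$. Then $x(xy)=(yx)x$ if and only if $x^2y=yx^2$.
   Context: A loop is a set with a binary operation in which all equations $ax=b$, $ya=b$ are uniquely solvable and which has a two-sided identity. For $a\in L$, $R_a:x\mapsto xa$, $L_a:x\mapsto ax$; the inner mapping group is the stabilizer of the identity in the group generated by all $R_a,L_a$. A loop is automorphic if every inner mapping is an automorphism. Automorphic loops are power associative, so $x^2=xx$ is unambiguous. *)

(* Defs.v *)
Definition is_loop {T : Type} (mul : T -> T -> T) (e : T) : Prop :=
  (forall a b : T, exists! x : T, mul a x = b) /\
  (forall a b : T, exists! y : T, mul y a = b) /\
  (forall x : T, mul e x = x /\ mul x e = x).

(* The multiplication group Mlt: the group of permutations of T generated by
   all R_a : x |-> x a and L_a : x |-> a x.  Its elements are the finite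
   compositions of the generators and their inverses. *)
Inductive mlt {T : Type} (mul : T -> T -> T) : (T -> T) -> Prop :=
| mlt_id : mlt mul (fun x => x)
| mlt_R (a : T) (f : T -> T) : mlt mul f -> mlt mul (fun x => mul (f x) a)
| mlt_L (a : T) (f : T -> T) : mlt mul f -> mlt mul (fun x => mul a (f x))
| mlt_Rinv (a : T) (g f : T -> T) :
    (forall x, mul (g x) a = x) -> (forall x, g (mul x a) = x) ->
    mlt mul f -> mlt mul (fun x => g (f x))
| mlt_Linv (a : T) (g f : T -> T) :
    (forall x, mul a (g x) = x) -> (forall x, g (mul a x) = x) ->
    mlt mul f -> mlt mul (fun x => g (f x)).

Definition inner_mapping {T : Type} (mul : T -> T -> T) (e : T) (f : T -> T) : Prop :=
  mlt mul f /\ f e = e.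

(* Automorphic loop: every inner mapping is an automorphism (elements of Mlt are
   bijections, so it suffices that they be multiplicative). *)
Definition automorphic {T : Type} (mul : T -> T -> T) (e : T) : Prop :=
  forall f : T -> T, inner_mapping mul e f ->
    forall x y : T, f (mul x y) = mul (f x) (f y).

(* Main.v *)
(* Write [T x], [L x y], [R x y] for the standard inner maps and [F p] for the
   reflection [z |-> p (p \ z)^-1].  The left condition says [T x (T x y) = y], the
   right one that [T (x x)] fixes [y].

   Right to left: put [p = y x] and [a = L y x x], so that [p a = y (x x)].  As
   [T (x x)] fixes [x] and [y], it fixes [p] and [a], so [T p] and [T a] fix
   [x x].  Since [T p o T a] always fixes [p a], it fixes [y]; and the inverse of
   [T p] maps [y] to [L y x (T x^-1 y)], whereas [T a y = L y x (T x y)].  Hence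
   [T x y = T x^-1 y].

   Left to right: the points fixed by [T x o T x] form a subloop containing [x]
   and [y], so one may assume that [T x] is an involution.  Inversion is an
   antiautomorphism, which makes [F] compatible with all translations:
   [F (x y) (x z) = x (F y z)] and [F (x y) (z y) = F x z y].  As both [F p] and
   [F (T x p)] map [x p] to [x^-1 p], the quotients [d = p \ T x p] satisfy
   [F d x = x^-1] and are inverted by [T x].  From these facts [x x] is shown to
   commute with everything. *)
From Stdlib Require Import ssreflect ssrfun ClassicalEpsilon ProofIrrelevance.
Require Import Defs.

Declare Scope loop_scope.
Local Open Scope loop_scope.

(** * Standard inner maps and automorphic loops as an equational structure *)

Section Maps.
Context {A : Type} (mul ldiv rdiv : A -> A -> A) (one : A).
Definition conj_map x y := rdiv (mul x y) x.
Definition left_map x y z := ldiv (mul x y) (mul x (mul y z)).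
Definition right_map x y z := rdiv (mul (mul z x) y) (mul x y).
End Maps.

(** Divisions are operations and all laws are equations, so that proofs proceed by rewriting;
    automorphy enters through the three standard families of inner maps. *)
Record aloop := Aloop {
  carrier :> Type;
  mul : carrier -> carrier -> carrier;
  ldiv : carrier -> carrier -> carrier;
  rdiv : carrier -> carrier -> carrier;
  one : carrier;
  mul1x : forall x, mul one x = x;
  mulx1 : forall x, mul x one = x;
  mulKx : forall x y, ldiv x (mul x y) = y;
  mulVKx : forall x y, mul x (ldiv x y) = y;
  mulxK : forall x y, rdiv (mul x y) y = x;
  divxK : forall x y, mul (rdiv x y) y = x;
  conj_map_mul : forall x y z, conj_map mul rdiv x (mul y z) =
    mul (conj_map mul rdiv x y) (conj_map mul rdiv x z);
  left_map_mul : forall x y z w, left_map mul ldiv x y (mul z w) =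
    mul (left_map mul ldiv x y z) (left_map mul ldiv x y w);
  right_map_mul : forall x y z w, right_map mul rdiv x y (mul z w) =
    mul (right_map mul rdiv x y z) (right_map mul rdiv x y w)
}.

Arguments mul {_}. Arguments ldiv {_}. Arguments rdiv {_}. Arguments one {_}.
Arguments mul1x {_}. Arguments mulx1 {_}. Arguments mulKx {_}.
Arguments mulVKx {_}. Arguments mulxK {_}. Arguments divxK {_}.

Notation "x * y" := (mul x y) : loop_scope.
Notation "x / y" := (rdiv x y) : loop_scope.
Notation "x \ y" := (ldiv x y) (at level 40, left associativity) : loop_scope.
Notation "x ^-1" := (ldiv x one)
  (at level 3, left associativity, format "x ^-1") : loop_scope.
Notation T := (conj_map mul rdiv).
Notation L := (left_map mul ldiv).
Notation R := (right_map mul rdiv).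

(** * Inner maps as automorphisms, flexibility and inverses *)

Section Basics.
Context {Q : aloop}.
Local Notation e := (@one Q).
Implicit Types x y z w : Q.

Lemma mulxI x y z : x * y = x * z -> y = z.
Proof. by move=> h; rewrite -(mulKx x y) h mulKx. Qed.

Lemma mulIx x y z : y * x = z * x -> y = z.
Proof. by move=> h; rewrite -(mulxK y x) h mulxK. Qed.

Lemma T_def x y : T x y * x = x * y.
Proof. exact: divxK. Qed.

Lemma L_def x y z : x * y * L x y z = x * (y * z).
Proof. exact: mulVKx. Qed.

Lemma R_def x y z : R x y z * (x * y) = z * x * y.
Proof. exact: divxK. Qed.

Lemma TM x y z : T x y * T x z = T x (y * z).
Proof. by rewrite conj_map_mul. Qed.

Lemma LM x y z w : L x y z * L x y w = L x y (z * w).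
Proof. by rewrite left_map_mul. Qed.

Lemma RM x y z w : R x y z * R x y w = R x y (z * w).
Proof. by rewrite right_map_mul. Qed.

Lemma Tldiv x y z : T x y \ T x z = T x (y \ z).
Proof. by rewrite -{1}(mulVKx y z) -TM mulKx. Qed.

Lemma Lldiv x y z w : L x y z \ L x y w = L x y (z \ w).
Proof. by rewrite -{1}(mulVKx z w) -LM mulKx. Qed.

Lemma Rldiv x y z w : R x y z \ R x y w = R x y (z \ w).
Proof. by rewrite -{1}(mulVKx z w) -RM mulKx. Qed.

Lemma Tx1 x : T x e = e.
Proof. by apply: (mulIx x); rewrite T_def mulx1 mul1x. Qed.

Lemma Lx1 x y : L x y e = e.
Proof. by apply: (mulxI (x * y)); rewrite L_def !mulx1. Qed.

Lemma Rx1 x y : R x y e = e.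
Proof. by apply: (mulIx (x * y)); rewrite R_def !mul1x. Qed.

Lemma TV x y : T x y^-1 = (T x y)^-1.
Proof. by rewrite -Tldiv Tx1. Qed.

Lemma LV x y z : L x y z^-1 = (L x y z)^-1.
Proof. by rewrite -Lldiv Lx1. Qed.

Lemma RV x y z : R x y z^-1 = (R x y z)^-1.
Proof. by rewrite -Rldiv Rx1. Qed.

Lemma Txx x : T x x = x.
Proof. by apply: (mulIx x); rewrite T_def. Qed.

(** [T x] is multiplicative and fixes [x], so [T x (y * x) = T x y * x = x * y]; now multiply by [x]
    on the right. *)
Lemma flex x y : x * y * x = x * (y * x).
Proof. by rewrite -(T_def x (y * x)) -TM Txx T_def. Qed.

Lemma mulxV x : x * x^-1 = e.
Proof. exact: mulVKx. Qed.

(** The inverse is defined as a right inverse; [T x] fixes it along with [x], so it commutes with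
    [x]. *)
Lemma mulVx x : x^-1 * x = e.
Proof. by have := T_def x x^-1; rewrite TV Txx mulxV. Qed.

Lemma invK x : x^-1^-1 = x.
Proof. by apply: (mulxI x^-1); rewrite mulxV mulVx. Qed.

Lemma invI x y : x^-1 = y^-1 -> x = y.
Proof. by move=> h; rewrite -(invK x) h invK. Qed.

(** Flexibility read through [L_def]. *)
Lemma L_fix x y : L x y x = x.
Proof. by apply: (mulxI (x * y)); rewrite L_def flex. Qed.

Lemma R_fix x y : R x y y = y.
Proof. by apply: (mulIx (x * y)); rewrite R_def flex. Qed.

Lemma T_swap x y : T x (y * x) = x * y.
Proof. by rewrite -TM Txx T_def. Qed.

(** [T y] takes [x * y] to [y * x], and [T x] takes it back. *)
Lemma TT_fix x y : T x (T y (x * y)) = x * y.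
Proof. by rewrite T_swap T_swap. Qed.

(** * The antiautomorphic inverse property *)

(** The map [z |-> x^-1 * (x * z)] is [L x^-1 x], an automorphism fixing [x^-1] and hence [x]; so it
    commutes with left multiplication by [x]. *)
Lemma mulVC x y : x^-1 * (x * y) = x * (x^-1 * y).
Proof.
have E z : x^-1 * (x * z) = L x^-1 x z by rewrite -L_def mulVx mul1x.
have Ex : L x^-1 x x = x by apply: invI; rewrite -LV L_fix.
have h : L x^-1 x (x * (x \ y)) = x * L x^-1 x (x \ y) by rewrite -LM Ex.
by rewrite -!E !mulVKx in h.
Qed.

Lemma mulCV x y : x * y^-1 * y = x * y * y^-1.
Proof.
have E z : z * y^-1 * y = R y^-1 y z by rewrite -R_def mulVx mulx1.
by apply: (mulIx y); rewrite !E -RM R_fix.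
Qed.

(* [inv_mul_1] to [inv_mul_42] are one equational derivation of [invM], obtained
   by Knuth-Bendix completion. *)
Lemma inv_mul_1 : e^-1 = e.
Proof.
have h := mulxV e; rewrite (mul1x e^-1) in h.
exact: h.
Qed.

Lemma inv_mul_2 x : x \ x = e.
Proof.
have h := mulKx x e; rewrite (mulx1 x) in h.
exact: h.
Qed.

Lemma inv_mul_3 x : T e x = x.
Proof.
have h := T_def e x; rewrite (mulx1 (T e x)) (mul1x x) in h.
exact: h.
Qed.

Lemma inv_mul_4 x : T x x = x.
Proof.
have h := inv_mul_3 (T x (e * x)); rewrite (TT_fix e x) (mul1x x) in h.
exact: esym h.
Qed.

Lemma inv_mul_6 x : e / x = x^-1.
Proof.
have h := mulxK x^-1 x; rewrite (mulVx x) in h.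
exact: h.
Qed.

Lemma inv_mul_7 x y : (x * y) / x = T x y.
Proof.
have h := mulxK (T x y) x; rewrite (T_def x y) in h.
exact: h.
Qed.

Lemma inv_mul_8 x : T x^-1 x = x.
Proof.
have h := inv_mul_7 x^-1 x; rewrite (mulVx x) (inv_mul_6 x^-1) (invK x) in h.
exact: esym h.
Qed.

Lemma inv_mul_9 x y : x * (x^-1 * y) = L x^-1 x y.
Proof.
have h := L_def x^-1 x y; rewrite (mulVx x) (mul1x (L x^-1 x y)) (mulVC x y) in
  h.
exact: esym h.
Qed.

Lemma inv_mul_10 x y : L x^-1 x y = L x x^-1 y.
Proof.
have h := L_def x x^-1 y; rewrite (mulxV x) (mul1x (L x x^-1 y)) (inv_mul_9 x
  y) in h.
exact: esym h.
Qed.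

Lemma inv_mul_11 x y : T x (T (x \ y) y) = y.
Proof.
have h := TT_fix x (x \ y); rewrite (mulVKx x y) in h.
exact: h.
Qed.

Lemma inv_mul_12 x y : T x (y * x) = x * y.
Proof.
have h := TM x y x; rewrite (inv_mul_4 x) (T_def x y) in h.
exact: esym h.
Qed.

Lemma inv_mul_13 x y : T x (x \ y) = y / x.
Proof.
have h := inv_mul_7 x (x \ y); rewrite (mulVKx x y) in h.
exact: esym h.
Qed.

Lemma inv_mul_14 x y z : x * (L y (y \ x) z) = y * ((y \ x) * z).
Proof.
have h := L_def y (y \ x) z; rewrite (mulVKx y x) in h.
exact: h.
Qed.

Lemma inv_mul_15 x y z : (x * y) \ (x * (y * z)) = L x y z.
Proof.
have h := mulKx (x * y) (L x y z); rewrite (L_def x y z) in h.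
exact: h.
Qed.

Lemma inv_mul_16 x y : L x y e = e.
Proof.
have h := inv_mul_15 x y e; rewrite (mulx1 y) (inv_mul_2 (x * y)) in h.
exact: esym h.
Qed.

Lemma inv_mul_17 x y : (x * y) * y^-1 = R y^-1 y x.
Proof.
have h := R_def y^-1 y x; rewrite (mulVx y) (mulx1 (R y^-1 y x)) (mulCV x y) in
  h.
exact: esym h.
Qed.

Lemma inv_mul_18 x y : R x^-1 x y = R x x^-1 y.
Proof.
have h := R_def x x^-1 y; rewrite (mulxV x) (mulx1 (R x x^-1 y)) (inv_mul_17 y
  x) in h.
exact: esym h.
Qed.

Lemma inv_mul_19 x y : x * ((x \ y) * x) = y * x.
Proof.
have h := flex x (x \ y); rewrite (mulVKx x y) in h.
exact: esym h.
Qed.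

Lemma inv_mul_20 x y z : ((x * y) * z) / (y * z) = R y z x.
Proof.
have h := mulxK (R y z x) (y * z); rewrite (R_def y z x) in h.
exact: h.
Qed.

Lemma inv_mul_21 x y : (x * y) \ x = (L x y y)^-1.
Proof.
have h := inv_mul_15 x y y^-1; rewrite (mulxV y) (mulx1 x) (LV x y y) in h.
exact: h.
Qed.

Lemma inv_mul_22 x y : x \ (y * x) = (x \ y) * x.
Proof.
have h := mulKx x ((x \ y) * x); rewrite (inv_mul_19 x y) in h.
exact: h.
Qed.

Lemma inv_mul_23 x y : x / (y * x) = (R y x y)^-1.
Proof.
have h := inv_mul_20 y^-1 y x; rewrite (mulVx y) (mul1x x) (RV y x y) in h.
exact: h.
Qed.

Lemma inv_mul_24 x y : ((x * y) \ x)^-1 = L x y y.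
Proof.
have h := invK (L x y y); rewrite -(inv_mul_21 x y) in h.
exact: h.
Qed.

Lemma inv_mul_25 x y : (x / (y * x))^-1 = R y x y.
Proof.
have h := invK (R y x y); rewrite -(inv_mul_23 x y) in h.
exact: h.
Qed.

Lemma inv_mul_26 x y : x^-1 * (x * y) = L x x^-1 y.
Proof.
have h := mulVC x y; rewrite (inv_mul_9 x y) (inv_mul_10 x y) in h.
exact: h.
Qed.

Lemma inv_mul_27 x y : x / (L x y^-1 y) = x * y^-1.
Proof.
have h := mulxK (x * y^-1) (L x y^-1 y); rewrite (L_def x y^-1 y) (mulVx y)
  (mulx1 x) in h.
exact: h.
Qed.

Lemma inv_mul_28 x y : (x * y) * y^-1 = R y y^-1 x.
Proof.
have h := R_def (T y y^-1) y x; rewrite (T_def y y^-1) (mulxV y) (TV y y)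
  (inv_mul_4 y) (inv_mul_18 y x) (mulx1 (R y y^-1 x)) (mulCV x y) in h.
exact: esym h.
Qed.

Lemma inv_mul_29 x y z w : (L x y z) * (L x y w)^-1 = L x y (z * w^-1).
Proof.
have h := LM x y z w^-1; rewrite (LV x y w) in h.
exact: h.
Qed.

Lemma inv_mul_30 x y z : T x ((y * x) * z) = (x * y) * (T x z).
Proof.
have h := TM x (T y (x * y)) z; rewrite (TT_fix x y) (inv_mul_12 y x) in h.
exact: esym h.
Qed.

Lemma inv_mul_31 x y : L x (x \ y) y = x * (y \ x)^-1.
Proof.
have h := LM x (x \ y) x (x \ y); rewrite (L_fix x (x \ y)) (mulVKx x y)
  -(inv_mul_24 x (x \ y)) (mulVKx x y) in h.
exact: esym h.
Qed.

Lemma inv_mul_32 x y : R (x / y) y x = (y / x)^-1 * y.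
Proof.
have h := RM (x / y) y (x / y) y; rewrite (R_fix (x / y) y) (divxK x y)
  -(inv_mul_25 y (x / y)) (divxK x y) in h.
exact: esym h.
Qed.

Lemma inv_mul_33 x y : T x ((x \ y) * y) = y * (y / x).
Proof.
have h := TM x (T (x \ y) y) (x \ y); rewrite (inv_mul_11 x y) (T_def (x \ y)
  y) (inv_mul_13 x y) in h.
exact: esym h.
Qed.

Lemma inv_mul_34 x y z : T x ((x \ y) * z) = (y / x) * (T x z).
Proof.
have h := TM x (x \ y) z; rewrite (inv_mul_13 x y) in h.
exact: esym h.
Qed.

Lemma inv_mul_35 x y z : (x * ((x \ y) * z)) / y = T y (L x (x \ y) z).
Proof.
have h := inv_mul_7 y (L x (x \ y) z); rewrite (inv_mul_14 y x z) in h.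
exact: h.
Qed.

Lemma inv_mul_36 x y : (x * (x / y)) \ (y * ((y \ x) * x)) = y.
Proof.
have h := mulKx (T y ((y \ x) * x)) y; rewrite (T_def y ((y \ x) * x))
  (inv_mul_33 y x) in h.
exact: h.
Qed.

(** Here left and right inner maps meet: the two sides evaluate [T x (L y (y \ x) x)] and
    [R (x / y) y x], both of which are the quotient by [x] of
    [y * ((y \ x) * x) = (x * (x / y)) * y]. *)
Lemma inv_mul_37 x y : T x (y * (x \ y)^-1) = (y / x)^-1 * y.
Proof.
have h := inv_mul_20 x (x / y) ((x * (x / y)) \ (y * ((y \ x) * x))); rewrite
  (mulVKx (x * (x / y)) (y * ((y \ x) * x))) (inv_mul_36 x y) (divxK x y)
  (inv_mul_35 y x x) (inv_mul_31 y x) (inv_mul_32 x y) in h.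
exact: h.
Qed.

(** Taking [y] and [x * y] in [inv_mul_37] yields [(y * x) * x^-1 = x^-1 * (x * y)]. *)
Lemma inv_mul_38 x y : R x x^-1 y = L x x^-1 y.
Proof.
have h := inv_mul_37 y (x * y); rewrite (inv_mul_30 y x (y \ (x * y))^-1)
  (inv_mul_22 y x) (TV y ((y \ x) * y)) (inv_mul_34 y x y) (inv_mul_4 y) (divxK
  x y) (inv_mul_28 y x) (mulxK x y) (inv_mul_26 x y) in h.
exact: h.
Qed.

Lemma inv_mul_39 x y : (x * y) * y^-1 = L y y^-1 x.
Proof.
have h := inv_mul_28 x y; rewrite (inv_mul_38 y x) in h.
exact: h.
Qed.

(** [L (x * y) y^-1] fixes [x * y]; dividing by its value at [y] gives its value at [x], namely
    [(x * y) * y^-1]. *)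
Lemma inv_mul_40 x y : L (x * y) y^-1 x = L y y^-1 x.
Proof.
have h := mulxK (L (x * y) y^-1 x) (L (x * y) y^-1 y); rewrite (LM (x * y) y^-1
  x y) (L_fix (x * y) y^-1) (inv_mul_27 (x * y) y) (inv_mul_39 x y) in h.
exact: esym h.
Qed.

(** As [(x * y) * y^-1] equals [L (x * y) y^-1 x], [L_def] factors the product into that element and
    its inverse. *)
Lemma inv_mul_41 x y : (x * y) * (y^-1 * x^-1) = e.
Proof.
have h := L_def (x * y) y^-1 x^-1; rewrite (LV (x * y) y^-1 x) (inv_mul_40 x y)
  (inv_mul_39 x y) (inv_mul_29 y y^-1 x x) (mulxV x) (inv_mul_16 y y^-1) in h.
exact: esym h.
Qed.

Lemma inv_mul_42 x y : x^-1 * y^-1 = (y * x)^-1.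
Proof.
(* The index of [T] is the inverse of a product equal to [e] by [inv_mul_41], so [T] is the identity
   here and only left cancellation remains. *)
have h := mulKx (T ((y * x) * (x^-1 * y^-1))^-1 (y * x)) (T ((y * x) * (x^-1 *
  y^-1))^-1 (x^-1 * y^-1)); rewrite (TM ((y * x) * (x^-1 * y^-1))^-1 (y * x)
  (x^-1 * y^-1)) (inv_mul_8 ((y * x) * (x^-1 * y^-1))) (inv_mul_41 y x)
  inv_mul_1 (inv_mul_3 (y * x)) (inv_mul_3 (x^-1 * y^-1)) in h.
exact: esym h.
Qed.

Lemma invM x y : x^-1 * y^-1 = (y * x)^-1.
Proof. exact: inv_mul_42. Qed.

(** * Reflections and their compatibility with translations *)

Definition F x y := x * (x \ y)^-1.

Lemma mulV_F x y : x * (x \ y)^-1 = F x y.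
Proof. by []. Qed.

(** [T y] carries [y \ x] to [x / y], which gives the reflection a right-handed form. *)
Lemma divV_F x y : (x / y)^-1 * y = F y x.
Proof.
have -> : x / y = T y (y \ x) by apply: (mulIx y); rewrite divxK T_def mulVKx.
by rewrite -TV T_def.
Qed.

Lemma FK x y : F x (F x y) = y.
Proof. by rewrite /F mulKx invK mulVKx. Qed.

Lemma F_mull x y z : F (x * y) (x * z) = x * F y z.
Proof.
have h : x * y \ (x * z) = L x y (y \ z) by rewrite -{1}(mulVKx y z) -L_def mulKx.
by rewrite /F h -LV L_def.
Qed.

(** Inverting [L_def] by [invM] produces the defining equation of [R y x]: right inner maps are left
    ones with inverted indices. *)
Lemma L_inv_def x y z : L x^-1 y^-1 z * (y * x) = z * y * x.
Proof.
by apply: invI; have := L_def x^-1 y^-1 z^-1; rewrite LV !invM.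
Qed.

(** Mirror image of [F_mull], using the right-handed form of [F] and [L_inv_def]. *)
Lemma F_mulr x y z : F (x * y) (z * y) = F x z * y.
Proof.
have h : z * y / (x * y) = L y^-1 x^-1 (z / x).
  by rewrite -{1}(divxK z x) -L_inv_def mulxK.
by rewrite -divV_F h -LV L_inv_def divV_F.
Qed.

Lemma F1x x : F e x = x^-1.
Proof. by rewrite /F mul1x -{1}(mul1x x) mulKx. Qed.

Lemma sqr_F x : x * x = F x e.
Proof. by rewrite /F invK. Qed.

Lemma F_mul_r x y : F (x * y) y = F x e * y.
Proof. by rewrite -{2}(mul1x y) F_mulr. Qed.

Lemma F_mul_l x y : F (x * y) x = x * F y e.
Proof. by rewrite -{2}(mulx1 x) F_mull. Qed.

Lemma FV x y : F x^-1 y^-1 = (F x y)^-1.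
Proof.
have h : x^-1 \ y^-1 = (y / x)^-1 by rewrite -{1}(divxK y x) -invM mulKx.
by rewrite -(divV_F y x) -invM /F h.
Qed.

Lemma TF x y z : F (T x y) (T x z) = T x (F y z).
Proof. by rewrite /F Tldiv -TV TM. Qed.

Lemma LF x y z w : F (L x y z) (L x y w) = L x y (F z w).
Proof. by rewrite /F Lldiv -LV LM. Qed.

(** * Conjugation and cocycle identities for inner maps *)

(** Inverting [T_def] gives [x^-1 * T x y = y * x^-1]. *)
Lemma TVK x y : T x^-1 (T x y) = y.
Proof.
apply: (mulIx x^-1); rewrite T_def.
apply: invI; rewrite -!invM invK -TV.
by rewrite T_def.
Qed.

Lemma L_fixV x y : L x^-1 y x = x.
Proof. by apply: invI; rewrite -LV L_fix. Qed.

(** An automorphism conjugates an inner map into the one with transported indices; the next two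
    lemmas are further instances. *)
Lemma L_T_mul x y z w : L x y (T z w) = T (L x y z) (L x y w).
Proof. by apply: (mulIx (L x y z)); rewrite T_def !LM T_def. Qed.

Lemma T_L x y z w : T x (L y z w) = L (T x y) (T x z) (T x w).
Proof. by apply: (mulxI (T x y * T x z)); rewrite L_def !TM L_def. Qed.

Lemma L_L_mul x y z w u : L x y (L z w u) = L (L x y z) (L x y w) (L x y u).
Proof. by apply: (mulxI (L x y z * L x y w)); rewrite L_def !LM L_def. Qed.

Lemma TKV x y : T x (T x^-1 y) = y.
Proof. by rewrite -{1}(invK x) TVK. Qed.

(** [L x y] fixes [x], hence commutes with [T x], while conjugation by [T x] turns it into
    [L x (T x y)]. *)
Lemma L_T x y z : L x (T x y) z = L x y z.
Proof.
by rewrite -{1}(Txx x) -[in LHS](TKV x z) -T_L -[in RHS](TKV x z)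
  (L_T_mul x y x) L_fix.
Qed.

(** Conjugate [L x y] by itself: the index [x] stays and [y] becomes [L x y y]. *)
Lemma L_L x y z : L x (L x y y) z = L x y z.
Proof.
have [w <-] : exists w, L x y w = z.
  by exists (y \ (x \ (x * y * z))); apply: (mulxI (x * y)); rewrite L_def !mulVKx.
by rewrite -{1}(L_fix x y) -L_L_mul.
Qed.

Lemma L_TV x y : L x y (T y^-1 x) = T (x * y)^-1 x.
Proof.
have TVE (u v : Q) : T u^-1 v = u \ (v * u).
  by apply: (mulxI u); rewrite mulVKx -(T_def u (T u^-1 v)) TKV.
by rewrite !TVE; apply: (mulxI (x * y)); rewrite L_def !mulVKx.
Qed.

(** Multiplied on the left by [x * (y * z)], both sides become [x * (y * (z * w))]. *)
Lemma L_cocycle x y z w : L x (y * z) (L y z w) = L (x * y) (L x y z) (L x y w).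
Proof.
apply: (mulxI (x * (y * z))).
by rewrite L_def L_def -[in RHS](L_def x y z) L_def LM L_def.
Qed.

Lemma L_V x y z : L x^-1 (x * y) (L x y z) = L x x^-1 z.
Proof.
have E (u : Q) : x^-1 * (x * u) = L x x^-1 u by rewrite mulVC -L_def mulxV mul1x.
by apply: (mulxI (x^-1 * (x * y))); rewrite L_def L_def !E LM.
Qed.

End Basics.

(** * Loops in which [T c] is an involution *)

Section Involution.
Context {Q : aloop} (c : Q).
Local Notation e := (@one Q).
Context (TcK : forall x : Q, T c (T c x) = x).
Implicit Types x y z w : Q.

Lemma Tc_ldiv x : T c (c \ x) = x / c.
Proof. by apply: (mulIx c); rewrite divxK T_def mulVKx. Qed.

Lemma Tc_mul x : T c (c * x) = x * c.
Proof. by rewrite -TM Txx -T_def TcK. Qed.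

Lemma TcV x : T c^-1 x = T c x.
Proof. by rewrite -{1}(TcK x) TVK. Qed.

Lemma F_mulc x : F x (c * x) = c^-1 * x.
Proof. by rewrite -{1}(mul1x x) F_mulr F1x. Qed.

(** With [F_mulc], the reflections in [x] and [T c x] agree at [c * x], here rewritten as
    [T c x * c]. *)
Lemma FTc_mulc x : F (T c x) (c * x) = c^-1 * x.
Proof.
by rewrite -(T_def c x) -{1}(mulx1 (T c x)) F_mull F1x -TcV T_def.
Qed.

(** It suffices that [T c] inverts [d]: then applying [T c] to [x * d = T c x] gives
    [T c x * d^-1 = x]. *)
Lemma Tc_commutator x : (x \ T c x)^-1 = T c x \ x.
Proof.
set d := x \ T c x; set m := d \ c.
have xd : x * d = T c x by rewrite mulVKx.
have dm : d * m = c by rewrite mulVKx.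
(* Translated by [x], the points [d] and [c] become [T c x] and [c * T c x], where [F_mulc]
   applies. *)
have Fd : F d c = c^-1.
  apply: (mulxI x); rewrite -F_mull xd.
  have -> : x * c = c * T c x by rewrite -(T_def c (T c x)) TcK.
  by rewrite F_mulc -(T_def c^-1 (T c x)) TVK.
(* [Fd] reads [d * m^-1 = c^-1]; its inverse is a second factorization of [c]. *)
have md : m * d^-1 = c by apply: invI; rewrite -invM invK.
have Td : T c d = d^-1.
  have Tm : T m d^-1 = d by apply: (mulIx m); rewrite T_def md dm.
  have Tm' : T m^-1 d = d^-1 by have := TVK m d^-1; rewrite Tm.
  (* For [c = d * m], [L_TV] gives [T c^-1 d = L d m d^-1], and [L d m] fixes [d]. *)
  by rewrite -TcV -{1}dm -L_TV Tm' LV L_fix.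
by apply: (mulxI (T c x)); rewrite mulVKx -Td TM xd TcK.
Qed.

(* [involution_1] to [involution_171] are one equational derivation of
   [square_central], obtained by Knuth-Bendix completion. *)
Lemma involution_1 : e^-1 = e.
Proof.
have h := mulxV e; rewrite (mul1x e^-1) in h.
exact: h.
Qed.

Lemma involution_2 x : x \ x = e.
Proof.
have h := mulKx x e; rewrite (mulx1 x) in h.
exact: h.
Qed.

Lemma involution_3 x y : x / (y \ x) = y.
Proof.
have h := mulxK y (y \ x); rewrite (mulVKx y x) in h.
exact: h.
Qed.

Lemma involution_4 x : x / e = x.
Proof.
have h := mulxK x e; rewrite (mulx1 x) in h.
exact: h.
Qed.

Lemma involution_5 x : x / x = e.
Proof.
have h := mulxK e x; rewrite (mul1x x) in h.
exact: h.
Qed.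

Lemma involution_6 x : T e x = x.
Proof.
have h := T_def e x; rewrite (mulx1 (T e x)) (mul1x x) in h.
exact: h.
Qed.

Lemma involution_7 x y : (x / y) \ x = y.
Proof.
have h := mulKx (x / y) y; rewrite (divxK x y) in h.
exact: h.
Qed.

Lemma involution_8 x : T x e = e.
Proof.
have h := involution_2 (T x e); rewrite (Tldiv x e e) (involution_2 e) in h.
exact: h.
Qed.

Lemma involution_9 x : T x x = x.
Proof.
have h := involution_6 (T x (e * x)); rewrite (TT_fix e x) (mul1x x) in h.
exact: esym h.
Qed.

Lemma involution_10 x y : (x * y^-1)^-1 = y * x^-1.
Proof.
have h := invM y^-1 x; rewrite (invK y) in h.
exact: esym h.
Qed.

Lemma involution_11 x y : L x y e = e.
Proof.
have h := involution_2 (L x y e); rewrite (Lldiv x y e e) (involution_2 e) in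
  h.
exact: h.
Qed.

Lemma involution_12 x y : (x^-1 * y)^-1 = y^-1 * x.
Proof.
have h := invM y x^-1; rewrite (invK x) in h.
exact: esym h.
Qed.

Lemma involution_13 x : T x^-1 x = x.
Proof.
have h := TVK x x; rewrite (involution_9 x) in h.
exact: h.
Qed.

Lemma involution_14 x y : (x * y)^-1 / x^-1 = y^-1.
Proof.
have h := mulxK y^-1 x^-1; rewrite (invM y x) in h.
exact: h.
Qed.

Lemma involution_15 x y : x^-1 \ (y * x)^-1 = y^-1.
Proof.
have h := mulKx x^-1 y^-1; rewrite (invM x y) in h.
exact: h.
Qed.

Lemma involution_16 x y : T x (T x^-1 y) = y.
Proof.
have h := TVK x^-1 y; rewrite (invK x) in h.
exact: h.
Qed.

Lemma involution_17 x y : (x * y) / x = T x y.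
Proof.
have h := mulxK (T x y) x; rewrite (T_def x y) in h.
exact: h.
Qed.

Lemma involution_18 x : (F x e) * x^-1 = x.
Proof.
have h := F_mul_r x x^-1; rewrite (mulxV x) (F1x x^-1) (invK x) in h.
exact: esym h.
Qed.

Lemma involution_19 x : x^-1 * (F x e) = x.
Proof.
have h := F_mul_l x^-1 x; rewrite (mulVx x) (F1x x^-1) (invK x) in h.
exact: esym h.
Qed.

Lemma involution_20 x : T (F x e)^-1 x = x.
Proof.
have h := L_TV x x; rewrite (involution_13 x) (L_fix x x) (sqr_F x) in h.
exact: esym h.
Qed.

Lemma involution_21 x : x^-1 \ x = F x e.
Proof.
have h := mulKx x^-1 (F x e); rewrite (involution_19 x) in h.
exact: h.
Qed.

Lemma involution_22 x y : T (x / y) (T y x) = x.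
Proof.
have h := TT_fix (x / y) y; rewrite (divxK x y) in h.
exact: h.
Qed.

Lemma involution_23 x y : T x (T (x \ y) y) = y.
Proof.
have h := TT_fix x (x \ y); rewrite (mulVKx x y) in h.
exact: h.
Qed.

Lemma involution_24 x : T c (x / c) = c \ x.
Proof.
have h := TcK (c \ x); rewrite (Tc_ldiv x) in h.
exact: h.
Qed.

Lemma involution_25 x y : x^-1 * (x * y) = L x^-1 x y.
Proof.
have h := L_def x^-1 x y; rewrite (mulVx x) (mul1x (L x^-1 x y)) in h.
exact: esym h.
Qed.

Lemma involution_26 x : (c \ x) * c = T c x.
Proof.
have h := Tc_mul (c \ x); rewrite (mulVKx c x) in h.
exact: esym h.
Qed.

Lemma involution_27 x : F x^-1 e = (F x e)^-1.
Proof.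
have h := sqr_F x^-1; rewrite (invM x x) (sqr_F x) in h.
exact: esym h.
Qed.

Lemma involution_28 x y : x * (x^-1 * y) = L x x^-1 y.
Proof.
have h := L_def x x^-1 y; rewrite (mulxV x) (mul1x (L x x^-1 y)) in h.
exact: esym h.
Qed.

Lemma involution_29 x y : T x (y * x) = x * y.
Proof.
have h := TM x y x; rewrite (involution_9 x) (T_def x y) in h.
exact: esym h.
Qed.

Lemma involution_30 x y : T x (x \ y) = y / x.
Proof.
have h := involution_17 x (x \ y); rewrite (mulVKx x y) in h.
exact: esym h.
Qed.

Lemma involution_31 x : x \ x^-1 = (F x e)^-1.
Proof.
have h := involution_15 x^-1 (F x e); rewrite (involution_18 x) (invK x) in h.
exact: h.
Qed.

Lemma involution_32 x y z : x * (L y (y \ x) z) = y * ((y \ x) * z).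
Proof.
have h := L_def y (y \ x) z; rewrite (mulVKx y x) in h.
exact: h.
Qed.

Lemma involution_33 x : x^-1 / x = (F x e)^-1.
Proof.
have h := involution_14 x^-1 (F x e); rewrite (involution_19 x) (invK x) in h.
exact: h.
Qed.

Lemma involution_34 x y z : (x * y) \ (x * (y * z)) = L x y z.
Proof.
have h := mulKx (x * y) (L x y z); rewrite (L_def x y z) in h.
exact: h.
Qed.

Lemma involution_35 x y : L x e y = y.
Proof.
have h := involution_34 x e y; rewrite (mulx1 x) (mul1x y) (mulKx x y) in h.
exact: esym h.
Qed.

Lemma involution_36 x : T x (F x e) = F x e.
Proof.
have h := involution_29 x x; rewrite (sqr_F x) in h.
exact: h.
Qed.

Lemma involution_37 x y : x * (y / x) = T x y.
Proof.
have h := involution_29 x (y / x); rewrite (divxK y x) in h.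
exact: esym h.
Qed.

Lemma involution_38 x y : x \ (T x y) = y / x.
Proof.
have h := mulKx x (y / x); rewrite (involution_37 x y) in h.
exact: h.
Qed.

Lemma involution_39 x y : x \ (F x y) = (x \ y)^-1.
Proof.
have h := mulKx x (x \ y)^-1; rewrite (mulV_F x y) in h.
exact: h.
Qed.

Lemma involution_40 x y : (F x y) / x = (y / x)^-1.
Proof.
have h := mulxK (y / x)^-1 x; rewrite (divV_F y x) in h.
exact: h.
Qed.

Lemma involution_41 x y : (F x^-1 y)^-1 = F x y^-1.
Proof.
have h := FV x^-1 y; rewrite (invK x) in h.
exact: esym h.
Qed.

Lemma involution_42 x y : (F x y^-1)^-1 = F x^-1 y.
Proof.
have h := FV x y^-1; rewrite (invK y) in h.
exact: esym h.
Qed.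

Lemma involution_43 x y : x * (y / x^-1)^-1 = y^-1.
Proof.
have h := involution_10 (y / x^-1) x; rewrite (divxK y x^-1) in h.
exact: esym h.
Qed.

Lemma involution_44 x y z : (T x y)^-1 \ (T x z) = T x (y^-1 \ z).
Proof.
have h := Tldiv x y^-1 z; rewrite (TV x y) in h.
exact: h.
Qed.

Lemma involution_45 x y : (x^-1 \ y)^-1 * x = y^-1.
Proof.
have h := involution_12 x (x^-1 \ y); rewrite (mulVKx x^-1 y) in h.
exact: esym h.
Qed.

Lemma involution_46 x y : x^-1 / y^-1 = (y \ x)^-1.
Proof.
have h := involution_14 y (y \ x); rewrite (mulVKx y x) in h.
exact: h.
Qed.

Lemma involution_47 x y : x^-1 \ y^-1 = (y / x)^-1.
Proof.
have h := involution_15 x (y / x); rewrite (divxK y x) in h.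
exact: h.
Qed.

Lemma involution_48 x y : x * (T x^-1 y) = y * x.
Proof.
have h := T_def x (T x^-1 y); rewrite (involution_16 x y) in h.
exact: esym h.
Qed.

Lemma involution_49 x : T (x * (F x e))^-1 x = x.
Proof.
have h := L_TV x (F x e); rewrite (involution_20 x) (L_fix x (F x e)) in h.
exact: esym h.
Qed.

Lemma involution_50 x y z : (T x y) * (T x z)^-1 = T x (y * z^-1).
Proof.
have h := TM x y z^-1; rewrite (TV x z) in h.
exact: h.
Qed.

Lemma involution_51 x : T (x * (F x e)) x = x.
Proof.
have h := involution_16 (x * (F x e)) x; rewrite (involution_49 x) in h.
exact: h.
Qed.

Lemma involution_52 x y : (T x y)^-1 * x = x * y^-1.
Proof.
have h := T_def x y^-1; rewrite (TV x y) in h.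
exact: h.
Qed.

Lemma involution_53 x y : T (x \ y) y = T x^-1 y.
Proof.
have h := TVK x (T (x \ y) y); rewrite (involution_23 x y) in h.
exact: esym h.
Qed.

Lemma involution_54 x y : T x^-1 (y / x) = x \ y.
Proof.
have h := TVK x (x \ y); rewrite (involution_30 x y) in h.
exact: h.
Qed.

Lemma involution_55 x : x * (F x e) = F x x^-1.
Proof.
have h := mulV_F x x^-1; rewrite (involution_31 x) (invK (F x e)) in h.
exact: h.
Qed.

Lemma involution_56 x : T (F x x^-1) x = x.
Proof.
have h := involution_51 x; rewrite (involution_55 x) in h.
exact: h.
Qed.

Lemma involution_57 x : (F x e) * x = F x x^-1.
Proof.
have h := divV_F x^-1 x; rewrite (involution_33 x) (invK (F x e)) in h.
exact: h.
Qed.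

Lemma involution_58 x y : (x / y^-1)^-1 = y \ x^-1.
Proof.
have h := mulKx y (x / y^-1)^-1; rewrite (involution_43 y x) in h.
exact: esym h.
Qed.

Lemma involution_59 x y : (x^-1 \ y)^-1 = y^-1 / x.
Proof.
have h := mulxK (x^-1 \ y)^-1 x; rewrite (involution_45 x y) in h.
exact: esym h.
Qed.

Lemma involution_60 x y z : L x y (x \ z) = x \ (L x y z).
Proof.
have h := Lldiv x y x z; rewrite (L_fix x y) in h.
exact: esym h.
Qed.

Lemma involution_61 x y : (x \ y^-1)^-1 = y / x^-1.
Proof.
have h := involution_46 y^-1 x; rewrite (invK y) in h.
exact: esym h.
Qed.

Lemma involution_62 x y : (x^-1 / y)^-1 = y^-1 \ x.
Proof.
have h := involution_47 y x^-1; rewrite (invK x) in h.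
exact: esym h.
Qed.

Lemma involution_63 x y : x \ (y * x) = T x^-1 y.
Proof.
have h := mulKx x (T x^-1 y); rewrite (involution_48 x y) in h.
exact: h.
Qed.

Lemma involution_64 x y z : L x y (z \ x) = (L x y z) \ x.
Proof.
have h := Lldiv x y z x; rewrite (L_fix x y) in h.
exact: esym h.
Qed.

Lemma involution_65 x y : (x \ y) * x = T x^-1 y.
Proof.
have h := TVK x ((x \ y) * x); rewrite (involution_29 x (x \ y)) (mulVKx x y)
  in h.
exact: esym h.
Qed.

Lemma involution_66 x y : x^-1 * (T x y) = y * x^-1.
Proof.
have h := T_def x^-1 (T x y); rewrite (TVK x y) in h.
exact: esym h.
Qed.

Lemma involution_67 x y : F (T x y) e = T x (F y e).
Proof.
have h := sqr_F (T x y); rewrite (TM x y y) (sqr_F y) in h.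
exact: esym h.
Qed.

Lemma involution_68 x y : (T x y) \ x = T x (y \ x).
Proof.
have h := Tldiv x y x; rewrite (involution_9 x) in h.
exact: h.
Qed.

Lemma involution_69 x y : (x \ y) * x^-1 = (F x y)^-1.
Proof.
have h := involution_10 x (x \ y); rewrite (mulV_F x y) in h.
exact: esym h.
Qed.

Lemma involution_70 x y : x^-1 * (y / x) = (F x y)^-1.
Proof.
have h := involution_12 (y / x) x; rewrite (divV_F y x) in h.
exact: esym h.
Qed.

Lemma involution_71 x y : (x \ y) \ (F x y)^-1 = x^-1.
Proof.
have h := involution_15 (x \ y)^-1 x; rewrite (mulV_F x y) (invK (x \ y)) in h.
exact: h.
Qed.

Lemma involution_72 x y : x / (x / y) = T (x / y) y.
Proof.
have h := involution_17 (x / y) y; rewrite (divxK x y) in h.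
exact: h.
Qed.

Lemma involution_73 x y z : (T x y) * (x * z) = T x (y * (z * x)).
Proof.
have h := TM x y (T z (x * z)); rewrite (TT_fix x z) (involution_29 z x) in h.
exact: h.
Qed.

Lemma involution_74 x y : (x * y) \ x = (L x y y)^-1.
Proof.
have h := involution_34 x y y^-1; rewrite (mulxV y) (mulx1 x) (LV x y y) in h.
exact: h.
Qed.

Lemma involution_75 x : L (F x e) x^-1 x = x.
Proof.
have h := involution_74 (F x e) x^-1; rewrite (involution_18 x) (involution_39
  x e) (invK x) (LV (F x e) x^-1 x) (invK (L (F x e) x^-1 x)) in h.
exact: esym h.
Qed.

Lemma involution_76 x y : L x^-1 x y = L x x^-1 y.
Proof.
have h := L_V x e y; rewrite (involution_35 x y) (mulx1 x) in h.
exact: h.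
Qed.

Lemma involution_77 x y : x \ (T x y)^-1 = y^-1 / x.
Proof.
have h := involution_38 x y^-1; rewrite (TV x y) in h.
exact: h.
Qed.

Lemma involution_78 x y : (x^-1 * y) * x = x^-1 * (y * x).
Proof.
have h := L_inv_def x y x^-1; rewrite (L_fix x^-1 y^-1) in h.
exact: esym h.
Qed.

Lemma involution_79 x y : ((x * y) \ x)^-1 = L x y y.
Proof.
have h := invK (L x y y); rewrite -(involution_74 x y) in h.
exact: h.
Qed.

(** In the cocycle identity for [F x e] and [x^-1], whose product is [x], every map involved fixes
    [x]. *)
Lemma involution_80 x y : L (F x e) y x = x.
Proof.
have h := L_cocycle (F x e) x^-1 (x^-1 \ y) x; rewrite (involution_75 x)
  (involution_18 x) (L_fix x (L (F x e) x^-1 (x^-1 \ y))) (L_fixV x (x^-1 \ y))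
  (mulVKx x^-1 y) in h.
exact: h.
Qed.

Lemma involution_81 x y : (F x y)^-1 * x = x^-1 * y.
Proof.
have h := involution_78 x (y / x); rewrite (involution_70 x y) (divxK y x) in
  h.
exact: h.
Qed.

Lemma involution_82 x y : (F x^-1 y) * x = (y * x)^-1.
Proof.
have h := involution_78 x (x^-1 \ y)^-1; rewrite (mulV_F x^-1 y) (involution_59
  x y) (divxK y^-1 x) (invM x y) in h.
exact: h.
Qed.

Lemma involution_83 x y : x / (T x y) = T x (x / y).
Proof.
have h := involution_3 x (T x (x / y)); rewrite (involution_68 x (x / y))
  (involution_7 x y) in h.
exact: h.
Qed.

Lemma involution_84 x y : (F x y^-1) * x^-1 = x * y.
Proof.
have h := involution_81 x^-1 y; rewrite (involution_41 x y) (invK x) in h.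
exact: h.
Qed.

Lemma involution_85 x y : (x * y)^-1 / y = F y^-1 x.
Proof.
have h := mulxK (F y^-1 x) y; rewrite (involution_82 y x) in h.
exact: h.
Qed.

Lemma involution_86 x y z : L x (T x y)^-1 z = L x y^-1 z.
Proof.
have h := L_T x y^-1 z; rewrite (TV x y) in h.
exact: h.
Qed.

Lemma involution_87 x y : x^-1 \ (y * x) = F x y^-1.
Proof.
have h := involution_62 (y * x) x; rewrite (involution_85 y x) (involution_41 x
  y) in h.
exact: esym h.
Qed.

Lemma involution_88 x y : F x (x \ y)^-1 = y / x^-1.
Proof.
have h := mulxK (F x (x \ y)^-1) x^-1; rewrite (involution_84 x (x \ y))
  (mulVKx x y) in h.
exact: esym h.
Qed.

Lemma involution_90 x : F (c \ x) x = c^-1 * (c \ x).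
Proof.
have h := F_mulc (c \ x); rewrite (mulVKx c x) in h.
exact: h.
Qed.

Lemma involution_91 x y : x^-1 * (x \ y) = F (x \ y) y.
Proof.
have h := divV_F y (x \ y); rewrite (involution_3 y x) in h.
exact: h.
Qed.

Lemma involution_92 x y z : L x (T x^-1 y) z = L x y z.
Proof.
have h := L_T x (T x^-1 y) z; rewrite (involution_16 x y) in h.
exact: esym h.
Qed.

Lemma involution_93 x y : x \ (L x x^-1 y) = x^-1 * y.
Proof.
have h := involution_25 x (x \ y); rewrite (mulVKx x y) (involution_76 x (x \
  y)) (involution_60 x x^-1 y) in h.
exact: esym h.
Qed.

Lemma involution_94 x y : L x x^-1 (x^-1 \ y) = x * y.
Proof.
have h := involution_28 x (x^-1 \ y); rewrite (mulVKx x^-1 y) in h.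
exact: esym h.
Qed.

Lemma involution_95 x y : (F (x / y) x) / y^-1 = x / y.
Proof.
have h := mulxK (x / y) ((x / y) \ x)^-1; rewrite (mulV_F (x / y) x)
  (involution_7 x y) in h.
exact: h.
Qed.

Lemma involution_96 x : (x / (T c x))^-1 = (T c x) / x.
Proof.
have h := involution_59 x (T c x^-1); rewrite (Tc_commutator x^-1) (TV c x)
  (involution_47 (T c x) x) (invK (T c x)) in h.
exact: h.
Qed.

Lemma involution_97 x y : L x^-1 y y = x / (y^-1 * x).
Proof.
have h := involution_61 (x^-1 * y) x; rewrite (involution_74 x^-1 y) (invK (L
  x^-1 y y)) (involution_12 x y) in h.
exact: h.
Qed.

Lemma involution_98 x y : ((x * y) \ x) * (L x y y) = e.
Proof.
have h := mulVx (L x y y); rewrite -(involution_74 x y) in h.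
exact: h.
Qed.

Lemma involution_99 x y : x^-1 * (x * y) = L x x^-1 y.
Proof.
have h := involution_25 x y; rewrite (involution_76 x y) in h.
exact: h.
Qed.

Lemma involution_100 x y : L x x^-1 (y / x) = y * x^-1.
Proof.
have h := L_inv_def x^-1 x (y / x); rewrite (mulxV x) (invK x) (mulx1 (L x x^-1
  (y / x))) (divxK y x) in h.
exact: h.
Qed.

Lemma involution_101 x y : T x (x / (T x^-1 y)) = x / y.
Proof.
have h := involution_83 x (T x^-1 y); rewrite (involution_16 x y) in h.
exact: esym h.
Qed.

Lemma involution_102 x y : (F x (x \ y)) \ (F x y) = x^-1.
Proof.
have h := mulKx (F x^-1^-1 (x \ y)) x^-1; rewrite (involution_82 x^-1 (x \ y))
  (involution_69 x y) (invK x) (invK (F x y)) in h.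
exact: h.
Qed.

Lemma involution_103 x : F (T c x) (x * c) = x * c^-1.
Proof.
have h := involution_90 (x * c); rewrite (involution_63 c x) (TcV x)
  (involution_66 c x) in h.
exact: h.
Qed.

Lemma involution_105 x : ((T c x) / x)^-1 = x / (T c x).
Proof.
have h := Tc_commutator (T c x^-1); rewrite (TcK x^-1) (involution_61 (T c
  x^-1) x) (TV c x) (invK (T c x)) (involution_47 x (T c x)) in h.
exact: esym h.
Qed.

Lemma involution_106 x y : (F (x / y) x) * y = x * y^-1.
Proof.
have h := involution_100 y^-1 (F (x / y) x); rewrite (involution_95 x y) (invK
  y) (involution_76 y (x / y)) (involution_100 y x) in h.
exact: esym h.
Qed.

Lemma involution_107 x : F (T c x) (x * c^-1) = x * c.
Proof.
have h := FK (T c x) (x * c); rewrite (involution_103 x) in h.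
exact: h.
Qed.

Lemma involution_108 x y z : L x^-1 y (L x (x \ y) z) = L x x^-1 z.
Proof.
have h := L_V x (x \ y) z; rewrite (mulVKx x y) in h.
exact: h.
Qed.

(** Either side times [L x y y^-1] is [x]. *)
Lemma involution_109 x y : L x y (x / y^-1) = x * y.
Proof.
have h := involution_108 x^-1 y (x^-1 \ y); rewrite (involution_97 x (x^-1 \
  y)) (invK x) (involution_59 x y) (divxK y^-1 x) (involution_76 x (x^-1 \ y))
  (involution_94 x y) in h.
exact: h.
Qed.

Lemma involution_110 x y : (x * y^-1) / y = F (x / y) x.
Proof.
have h := mulxK (F (x / y) x) y; rewrite (involution_106 x y) in h.
exact: h.
Qed.

Lemma involution_111 x y z : x * (F (x \ y) z) = F y (x * z).
Proof.
have h := F_mull x (x \ y) z; rewrite (mulVKx x y) in h.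
exact: esym h.
Qed.

Lemma involution_112 x : (T c x) / (c \ x) = T (c \ x) c.
Proof.
have h := involution_17 (c \ x) c; rewrite (involution_26 x) in h.
exact: h.
Qed.

Lemma involution_114 x y z : L x (y / x) z = L x (x \ y) z.
Proof.
have h := L_T x (x \ y) z; rewrite (involution_30 x y) in h.
exact: h.
Qed.

Lemma involution_115 x y : (T x y)^-1 \ x = T x (y^-1 \ x).
Proof.
have h := involution_44 x y x; rewrite (involution_9 x) in h.
exact: h.
Qed.

Lemma involution_116 x y z : T (T x y) (T x z) = T x (T y z).
Proof.
have h := involution_63 (T x y)^-1 (T x z); rewrite (involution_50 x z y)
  (involution_44 x y (z * y^-1)) (involution_63 y^-1 z) (invK y) (invK (T x y))
  in h.
exact: esym h.
Qed.

Lemma involution_117 x y z : (L x y (z / x)) * x = L x y z.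
Proof.
have h := LM x y (z / x) x; rewrite (L_fix x y) (divxK z x) in h.
exact: h.
Qed.

Lemma involution_118 x y : T x (T (x \ y) x) = T (y / x) x.
Proof.
have h := involution_37 (T x (x \ y)) x; rewrite (involution_83 x (x \ y)) (TM
  x (x \ y) (x / (x \ y))) (involution_37 (x \ y) x) (involution_30 x y) in h.
exact: h.
Qed.

Lemma involution_119 x : F (c \ x)^-1 (F c x) = (T c x)^-1.
Proof.
have h := involution_90 (F c x); rewrite (involution_39 c x) (invM c (c \ x))
  (involution_65 c x) (TcV x) in h.
exact: h.
Qed.

Lemma involution_120 x y : x / (T x^-1 y) = T x^-1 (x / y).
Proof.
have h := TVK x (x / (T x^-1 y)); rewrite (involution_101 x y) in h.
exact: esym h.
Qed.

Lemma involution_121 x y : T x (F (x \ y)^-1 (F x y)) = y^-1.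
Proof.
have h := involution_16 x ((x \ (F x y)) * x^-1); rewrite (involution_29 x^-1
  (x \ (F x y))) (involution_91 x (F x y)) (involution_69 x (F x y))
  (involution_39 x y) (FK x y) in h.
exact: h.
Qed.

Lemma involution_122 x y z : x \ (F y (x * z)) = F (x \ y) z.
Proof.
have h := mulKx x (F (x \ y) z); rewrite (involution_111 x y z) in h.
exact: h.
Qed.

(** * Elements built from [c] and commutators that have the same square as [c] *)

Lemma involution_123 x : F (x \ (T c x)) c^-1 = c.
Proof.
have h := involution_122 x (T c x) c^-1; rewrite (involution_107 x) (mulKx x c)
  in h.
exact: esym h.
Qed.

(** This is [involution_123] at [(T c x)^-1], which [T c] maps to [x^-1]. *)
Lemma involution_124 x : F ((T c x) / x) c^-1 = c.
Proof.
have h := involution_123 (F (c \ x)^-1 (F c x)); rewrite (involution_121 c x)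
  (involution_119 x) (involution_47 (T c x) x) (involution_96 x) in h.
exact: h.
Qed.

Lemma involution_125 x y : L x (x \ y) y = x * (y \ x)^-1.
Proof.
have h := involution_117 x (y / x) y; rewrite -(involution_79 x (y / x))
  (involution_37 x y) (involution_68 x y) (involution_52 x (y \ x))
  (involution_114 x y y) in h.
exact: esym h.
Qed.

Lemma involution_126 x y z : L x y (z / x) = (L x y z) / x.
Proof.
have h := mulxK (L x y (z / x)) x; rewrite (involution_117 x y z) in h.
exact: esym h.
Qed.

(** Translate [involution_124] by [c] on the left. Here [F z e] stands for the square of [z]. *)
Lemma involution_127 x : F (c * ((T c x) / x)) e = F c e.
Proof.
have h := F_mull c^-1^-1 ((T c x) / x) c^-1; rewrite (mulVx c^-1)
  (involution_124 x) (invK c) (sqr_F c) in h.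
exact: h.
Qed.

(** Put [d = T c x / x]. [T d o T c] fixes [d * c = T c (c * d)], hence its square, which is [F c e]
    by [involution_127]; and [T c] fixes [F c e]. *)
Lemma involution_128 x : T ((T c x) / x) (F c e) = F c e.
Proof.
have h := involution_67 ((T c (c * ((T c x) / x))) / (c \ (c * ((T c x) / x))))
  (T (c \ (c * ((T c x) / x))) (T c (c * ((T c x) / x)))); rewrite
  (involution_22 (T c (c * ((T c x) / x))) (c \ (c * ((T c x) / x))))
  (involution_67 (c \ (c * ((T c x) / x))) (T c (c * ((T c x) / x))))
  (involution_112 (c * ((T c x) / x))) (involution_67 c (c * ((T c x) / x)))
  (involution_116 (c \ (c * ((T c x) / x))) c (T c (F (c * ((T c x) / x)) e)))
  (TcK (F (c * ((T c x) / x)) e)) (involution_127 x) (mulKx c ((T c x) / x))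
  (involution_36 c) in h.
exact: esym h.
Qed.

Lemma involution_129 x y z : (T x (y^-1 \ z))^-1 = T x (z^-1 / y).
Proof.
have h := TV x (y^-1 \ z); rewrite (involution_59 y z) in h.
exact: esym h.
Qed.

Lemma involution_130 x y : L (T (F x x^-1) (F x e)) y x = x.
Proof.
have h := involution_80 (T (F x x^-1) x) y; rewrite (involution_67 (F x x^-1)
  x) (involution_56 x) in h.
exact: h.
Qed.

Lemma involution_131 x : F (c \ x^-1) (F c^-1 x) = (T c x)^-1.
Proof.
have h := FK (T c (c^-1 \ x)^-1) (c * (c^-1 \ x)^-1); rewrite (FTc_mulc (c^-1 \
  x)^-1) (mulV_F c^-1 x) (involution_59 c x) (involution_24 x^-1)
  (involution_37 c x^-1) (TV c x) in h.
exact: h.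
Qed.

Lemma involution_132 x y : L x (y \ x)^-1 y = x * (y \ x)^-1.
Proof.
have h := mulxK (x * (y \ x)^-1) (L x (y \ x)^-1 (y \ x)); rewrite (L_def x (y
  \ x)^-1 (y \ x)) (mulVx (y \ x)) (mulx1 x) (involution_64 x (y \ x)^-1 y)
  (involution_3 x (L x (y \ x)^-1 y)) in h.
exact: h.
Qed.

Lemma involution_133 x y z : F (x^-1 * y) z^-1 = (F (y^-1 * x) z)^-1.
Proof.
have h := FV (y^-1 * x) z; rewrite (involution_12 y x) in h.
exact: h.
Qed.

Lemma involution_134 x y : (F (x^-1 * y) y)^-1 = y^-1 * (F x e).
Proof.
have h := involution_70 (x^-1 * y) y; rewrite -(involution_97 y x)
  (involution_12 x y) (L_def y^-1 x x) (sqr_F x) in h.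
exact: esym h.
Qed.

Lemma involution_135 x y z : T x (T (T x^-1 y) z) = T y (T x z).
Proof.
have h := involution_116 x (T x^-1 y) z; rewrite (involution_16 x y) in h.
exact: esym h.
Qed.

Lemma involution_136 x y : T x (F (x \ y^-1) (F x^-1 y)) = y^-1.
Proof.
have h := involution_16 x (x^-1 \ ((F x^-1 y) * x^-1^-1)); rewrite
  (involution_30 x^-1 ((F x^-1 y) * x^-1^-1)) (involution_110 (F x^-1 y) x^-1)
  (invK x) (involution_87 x (F x^-1 y)) (involution_40 x^-1 y) (involution_58 y
  x) (involution_41 x y) (FK x y^-1) in h.
exact: h.
Qed.

Lemma involution_137 x y : T ((F x x^-1) \ (F x e)) (T x y) = y.
Proof.
have h := TVK (L (F x e) x x) y; rewrite -(involution_74 (F x e) x)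
  (involution_80 x x) (involution_57 x) in h.
exact: h.
Qed.

Lemma involution_138 x y : L (T (F x x^-1) (F x e))^-1 y x = x.
Proof.
have h := involution_108 (T (F x x^-1) (F x e)) y x; rewrite (involution_130 x
  ((T (F x x^-1) (F x e)) \ y)) (involution_130 x (T (F x x^-1) (F x e))^-1) in
  h.
exact: h.
Qed.

Lemma involution_139 x y : T x^-1 (y / (y / x)) = T (x \ y) x.
Proof.
have h := TVK x (T (x \ y) x); rewrite (involution_118 x y) -(involution_72 y
  x) in h.
exact: h.
Qed.

(** With [d = x \ T c x], apply to [F d c^-1 = c] the automorphism [L c^-1 (d \ c^-1)^-1], which
    fixes [c] and [c^-1]. *)
Lemma involution_140 x : c^-1 * (F (c / ((T c x) \ x)) e) = c.
Proof.
have h := LF c^-1 ((x \ (T c x)) \ c^-1)^-1 (x \ (T c x)) c^-1; rewrite (L_fix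
  c^-1 ((x \ (T c x)) \ c^-1)^-1) (involution_123 x) (L_fixV c ((x \ (T c x)) \
  c^-1)^-1) (involution_132 c^-1 (x \ (T c x))) (involution_61 (x \ (T c x)) c)
  (Tc_commutator x) (involution_133 c (c / ((T c x) \ x)) c) (involution_134 (c
  / ((T c x) \ x)) c) in h.
exact: h.
Qed.

Lemma involution_141 x : F (c / (x / (T c x))) e = F c e.
Proof.
have h := mulKx c^-1 (F (c / ((T c (F (c \ x^-1) (F c^-1 x))) \ (F (c \ x^-1)
  (F c^-1 x)))) e); rewrite (involution_140 (F (c \ x^-1) (F c^-1 x)))
  (involution_21 c) (involution_136 c x) (involution_131 x) (involution_47 x (T
  c x)) (involution_105 x) in h.
exact: esym h.
Qed.

(** The inverse of [T (x / T c x)] turns the right quotient of [involution_141] into the left one,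
    and fixes [F c e] by [involution_128]. *)
Lemma involution_142 x : F ((x / (T c x)) \ c) e = F c e.
Proof.
have h := involution_67 (x / (T c x))^-1 (c / (x / (T c x))); rewrite
  (involution_54 (x / (T c x)) c) (involution_141 x) (involution_96 x)
  (involution_128 x) in h.
exact: h.
Qed.

Lemma involution_143 x : F ((x / (T c x)) \ c) (F c e) = e.
Proof.
have h := involution_69 (((x / (T c x)) \ c) \ e) (F ((x / (T c x)) \ c) e)^-1;
  rewrite (involution_71 ((x / (T c x)) \ c) e) (invM ((x / (T c x)) \ c) (((x
  / (T c x)) \ c) \ e)) (involution_65 ((x / (T c x)) \ c) e) (involution_42
  (((x / (T c x)) \ c) \ e) (F ((x / (T c x)) \ c) e)) (involution_142 x) (invK
  ((x / (T c x)) \ c)) (involution_8 ((x / (T c x)) \ c)^-1) involution_1 in h.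
exact: esym h.
Qed.

Lemma involution_144 x y : (T x y) \ (F x e) = T x (y \ (F x e)).
Proof.
have h := Tldiv x y (F x e); rewrite (involution_36 x) in h.
exact: h.
Qed.

Lemma involution_145 x y z : x^-1 \ (y * z^-1) = ((z * y^-1) / x)^-1.
Proof.
have h := involution_47 x (z * y^-1); rewrite (involution_10 z y) in h.
exact: h.
Qed.

Lemma involution_146 x y z : L x y (x^-1 \ z) = x^-1 \ (L x y z).
Proof.
have h := Lldiv x y x^-1 z; rewrite (LV x y x) (L_fix x y) in h.
exact: esym h.
Qed.

Lemma involution_147 x y z : T x ((y * z) \ y) = (T x (L y z z))^-1.
Proof.
have h := TV x (L y z z); rewrite -(involution_74 y z) in h.
exact: h.
Qed.

Lemma involution_148 x y : (T c x)^-1 \ (y * c) = T c (x^-1 \ (c * y)).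
Proof.
have h := involution_44 c x (c * y); rewrite (Tc_mul y) in h.
exact: h.
Qed.

Lemma involution_149 x y : (T (F x x^-1) y)^-1 * x = T (F x x^-1) (y^-1 * x).
Proof.
have h := TM (x * (F x e)) y^-1 x; rewrite (TV (x * (F x e)) y) (involution_51
  x) (involution_55 x) in h.
exact: h.
Qed.

Lemma involution_150 x y z : L x y (z / x^-1) = (L x y z) / x^-1.
Proof.
have h := LF x y x (x \ z)^-1; rewrite (L_fix x y) (involution_88 x z) (LV x y
  (x \ z)) (involution_60 x y z) (involution_88 x (L x y z)) in h.
exact: esym h.
Qed.

Lemma involution_151 x y : L (T x y) (T x y)^-1 x = T x (L y y^-1 x).
Proof.
have h := involution_28 (T x y) x; rewrite (involution_52 x y) (involution_73 x
  y y^-1) (involution_28 y x) in h.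
exact: esym h.
Qed.

Lemma involution_152 x y : (T (x \ y) x) / x = x \ (T (y / x) x).
Proof.
have h := involution_38 x (T (x \ y) x); rewrite (involution_118 x y) in h.
exact: esym h.
Qed.

Lemma involution_153 x y z : L x (x^-1 / y) z = L x (x \ y^-1) z.
Proof.
have h := L_L x ((T x y)^-1 / x) z; rewrite (involution_126 x ((T x y)^-1 / x)
  (T x y)^-1) (involution_114 x (T x y)^-1 (T x y)^-1) (involution_125 x (T x
  y)^-1) (involution_17 x ((T x y)^-1 \ x)^-1) (TV x ((T x y)^-1 \ x))
  (involution_86 x ((T x y)^-1 \ x) z) (involution_114 x (T x y)^-1 z)
  (involution_115 x y) (involution_129 x y x) (L_T x (x^-1 / y) z)
  (involution_77 x y) (involution_114 x y^-1 z) in h.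
exact: h.
Qed.

Lemma involution_154 x y : L x (x \ y^-1) y = (x * (x^-1 / y))^-1.
Proof.
have h := involution_34 x (x^-1 / y) y; rewrite (divxK x^-1 y) (mulxV x)
  (involution_153 x y y) in h.
exact: esym h.
Qed.

Lemma involution_155 x y : ((x * y) \ x)^-1 / (L x y y) = e.
Proof.
have h := involution_101 ((x * y) \ x)^-1 ((x * y) \ x)^-1; rewrite (TV ((x *
  y) \ x)^-1^-1 ((x * y) \ x)) (involution_147 ((x * y) \ x)^-1^-1 x y) (invK
  (T ((x * y) \ x)^-1^-1 (L x y y))) (involution_120 ((x * y) \ x)^-1 (L x y
  y)) (involution_16 ((x * y) \ x)^-1 (((x * y) \ x)^-1 / (L x y y)))
  (involution_5 ((x * y) \ x)^-1) in h.
exact: h.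
Qed.

Lemma involution_156 x y : (L x y y) \ ((x * y) \ x)^-1 = e.
Proof.
have h := involution_38 (L x y y)^-1^-1 (T (L x y y)^-1 (((x * y) \ x)^-1 /
  (((x * y) \ x)^-1 / (L x y y)))); rewrite (TVK (L x y y)^-1 (((x * y) \ x)^-1
  / (((x * y) \ x)^-1 / (L x y y)))) (involution_139 (L x y y) ((x * y) \
  x)^-1) (invK (L x y y)) (involution_152 (L x y y) ((x * y) \ x)^-1)
  (involution_155 x y) (involution_6 (L x y y)) (Lldiv x y y y) (involution_2
  y) (involution_11 x y) (involution_4 ((x * y) \ x)^-1) in h.
exact: h.
Qed.

(** Apply [L x y] to [z = w * (w \ z)] with [w = x / y^-1], which it maps to [x * y]. *)
Lemma involution_157 x y z : x * (y * ((x / y^-1) \ z)) = L x y z.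
Proof.
have h := LM x y (x / y^-1) ((x / y^-1) \ z); rewrite (involution_109 x y)
  (L_def x y ((x / y^-1) \ z)) (mulVKx (x / y^-1) z) in h.
exact: h.
Qed.

Lemma involution_158 x y z : ((x * y) \ x)^-1 * ((L x y y) \ z) = z.
Proof.
have h := involution_32 ((x * y) \ x)^-1 (L x y y) ((L x y y) \ z); rewrite
  (involution_60 (L x y y) ((L x y y) \ ((x * y) \ x)^-1) z) (involution_156 x
  y) (involution_35 (L x y y) z) (mul1x ((L x y y) \ z)) (mulVKx (L x y y) z)
  in h.
exact: h.
Qed.

Lemma involution_159 x y z : x \ (L x y z) = y * ((x / y^-1) \ z).
Proof.
have h := mulKx x (L (x * (y * ((x / y^-1) \ z))) ((x * (y * ((x / y^-1) \ z)))
  \ x) (L x (y * ((x / y^-1) \ z)) (y * ((x / y^-1) \ z)))); rewrite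
  (involution_32 x (x * (y * ((x / y^-1) \ z))) (L x (y * ((x / y^-1) \ z)) (y
  * ((x / y^-1) \ z)))) (involution_98 x (y * ((x / y^-1) \ z))) (mulx1 (x * (y
  * ((x / y^-1) \ z)))) (mulKx x (y * ((x / y^-1) \ z))) (involution_157 x y z)
  -(involution_79 x (y * ((x / y^-1) \ z))) (involution_157 x y z) (LV (L x y
  z) ((L x y z) \ x) ((L x y z) \ x)) (involution_60 (L x y z) ((L x y z) \ x)
  x) (involution_125 (L x y z) x) (mulKx (L x y z) (x \ (L x y z))^-1) (invK (x
  \ (L x y z))) in h.
exact: esym h.
Qed.

Lemma involution_160 x y : T x (T (F x (x \ y))^-1 (F x y)) = F x y.
Proof.
have h := TVK ((F x (x \ y)) \ (F x y)) (F x y); rewrite (involution_53 (F x (x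
  \ y)) (F x y)) (involution_102 x y) (invK x) in h.
exact: h.
Qed.

Lemma involution_161 x y : x \ (T (F y^-1 y) (F y e)) = x \ (F y e).
Proof.
have h := Tldiv ((F y y^-1) \ (F y e)) (T y x) (F y e); rewrite (involution_53
  (F y y^-1) (F y e)) (involution_137 y x) (involution_42 y y) (involution_144
  y x) (involution_137 y (x \ (F y e))) in h.
exact: h.
Qed.

Lemma involution_162 x y : ((T (F x x^-1) (F x e)) / x) * (x \ y) = y.
Proof.
have h := involution_158 (T (F x x^-1) (F x e))^-1 x y; rewrite (involution_138
  x x) (involution_149 x (F x e)) (involution_81 x e) (mulx1 x^-1) (TV (F x
  x^-1) x) (involution_56 x) (involution_47 x (T (F x x^-1) (F x e))) (invK ((T
  (F x x^-1) (F x e)) / x)) in h.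
exact: h.
Qed.

(** The cocycle identity at [x / z^-1]: [L x z] sends this point to [x * z], which the remaining
    outer map fixes. *)
Lemma involution_163 x y z : L x (y * z) ((L z y x) / z^-1) = x * z.
Proof.
have h := L_cocycle x z (z \ (y * z)) (x / z^-1); rewrite (mulVKx z (y * z))
  (involution_109 x z) (L_fix (x * z) (L x z (z \ (y * z)))) (involution_150 z
  (z \ (y * z)) x) (involution_63 z y) (involution_92 z y x) in h.
exact: h.
Qed.

(** In [involution_163] the middle factor is chosen so that the second index becomes [(T y^-1 x)^-1]
    and the argument [x^-1 \ y]. *)
Lemma involution_164 x y : x^-1 \ (L x (T y^-1 x)^-1 y) = x * y.
Proof.
have h := involution_163 x (y \ x^-1) y; rewrite (involution_154 y x)
  (involution_65 y x^-1) (TV y^-1 x) (involution_46 (y * (y^-1 / x)) y) (mulKx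
  y (y^-1 / x)) (involution_62 y x) (involution_146 x (T y^-1 x)^-1 y) in h.
exact: h.
Qed.

Lemma involution_165 x y : L x (T y^-1 x)^-1 y = L x x^-1 y.
Proof.
have h := involution_162 x^-1 (L x (T y^-1 x)^-1 y); rewrite (involution_164 x
  y) (invK x) (involution_27 x) (TV (F x^-1 x) (F x e)) (involution_46 (T (F
  x^-1 x) (F x e)) x) (involution_161 x x) (involution_39 x e) (invK x)
  (involution_99 x y) in h.
exact: esym h.
Qed.

Lemma involution_166 x : L x (T c x)^-1 c = L x x^-1 c.
Proof.
have h := involution_34 (T c (T c x)) (T c (T c^-1 (T c x))^-1) c; rewrite
  (T_def c (T c^-1 (T c x))^-1) (involution_73 c (T c x) (T c^-1 (T c x))^-1)
  (TM c (T c x) (T c^-1 (T c x))^-1) (Tldiv c ((T c x) * (T c^-1 (T c x))^-1)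
  ((T c x) * ((T c^-1 (T c x))^-1 * c))) (involution_34 (T c x) (T c^-1 (T c
  x))^-1 c) (TcK x) (involution_165 (T c x) c) (involution_151 c x) (TcK (L x
  x^-1 c)) (TcV (T c x)) (TcK x) (TV c x) in h.
exact: esym h.
Qed.

(** * Centrality of the square of [c] *)

(** By [involution_159] and [involution_166], [(T c x)^-1] times the left side is [x^-1 * c]. So the
    conjugate [T x c] is tied to a quotient whose square is known. *)
Lemma involution_167 x : (x / (T c x)) \ c = T c (T x c).
Proof.
have h := mulKx (T c x)^-1 ((x / (T c x)^-1^-1) \ c); rewrite -(involution_159
  x (T c x)^-1 c) (involution_166 x) (involution_93 x c) (involution_148 x
  x^-1) (involution_145 x c x) (involution_17 x c^-1) (TV x c) (invK (T x c))
  (invK (T c x)) in h.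
exact: esym h.
Qed.

Lemma involution_168 x : F ((T x c) / c) c = c^-1.
Proof.
have h := involution_122 c ((x / (T c x)) \ c) c; rewrite (sqr_F c)
  (involution_143 x) (involution_167 x) (involution_38 c (T x c)) in h.
exact: esym h.
Qed.

Lemma involution_169 x : F (T x c) (F c e) = e.
Proof.
have h := F_mulr ((T x c) / c) c c; rewrite (divxK (T x c) c) (involution_168
  x) (mulVx c) (sqr_F c) in h.
exact: h.
Qed.

(** [involution_169] says that [T x c] has the square [F c e]; but its square is [T x (F c e)]. *)
Lemma involution_170 x : T x (F c e) = F c e.
Proof.
have h := TF (T x c) (T x c) (T (F (T x c) ((T x c) \ (F c e)))^-1 (F (T x c)
  (F c e))); rewrite (involution_9 (T x c)) (involution_160 (T x c) (F c e))
  (FK (T x c) (F c e)) (involution_169 x) (involution_8 (F (T x c) ((T x c) \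
  (F c e)))^-1) (involution_67 x c) (involution_116 x c (F c e)) (involution_36
  c) in h.
exact: esym h.
Qed.

Lemma involution_171 x : x * (F c e) = (F c e) * x.
Proof.
have h := T_def x (T (T x^-1 e) (F c e)); rewrite (involution_135 x e (F c e))
  (involution_170 (T x^-1 e)) (involution_170 x) (involution_170 e) in h.
exact: esym h.
Qed.

Lemma square_central x : c * c * x = x * (c * c).
Proof. by rewrite sqr_F involution_171. Qed.

End Involution.

(** * The two commutation conditions in terms of [T] *)

Section Conditions.
Context {Q : aloop} (x y : Q).

(** Write [x * y] as [T x y * x], use flexibility, and cancel [x] twice. *)
Lemma conj_involutionE : x * (x * y) = y * x * x <-> T x (T x y) = y.
Proof.
rewrite -(T_def x y) -flex; split=> [h | {2}<-].
  by apply: (mulIx x); rewrite T_def; apply: (mulIx x).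
by rewrite T_def.
Qed.

Lemma square_commutes_conj : x * x * y = y * (x * x) -> T x (T x y) = y.
Proof.
set q := x * x => qy; set p := y * x; set a := L y x x.
have Tq z : q * z = z * q -> T q z = z.
  by move=> qz; apply: (mulIx q); rewrite T_def.
have Tzq z : T q z = z -> T z q = q.
  by move=> qz; apply: (mulIx z); rewrite T_def -{1}qz T_def.
have qx : T q x = x by apply: Tq; rewrite flex.
have qyT : T q y = y by apply: Tq.
have qp : T q p = p by rewrite -TM qx qyT.
have qa : T q a = a by rewrite T_L qx qyT.
have pa : p * a = y * q by rewrite L_def.
have Ty : T p (T a y) = y.
  have := TT_fix p a; rewrite pa -(TM a y q) -(TM p _ _) (Tzq _ qa) (Tzq _ qp).
  exact: mulIx.
have Lxy : L y x (T x y) = L y x (T x^-1 y).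
  (* The sides are [T a y] and [T p^-1 y], which [Ty] identifies. *)
  by rewrite L_TV L_T_mul L_fix -/a -/p -{2}Ty TVK.
suff -> : T x y = T x^-1 y by rewrite TKV.
by apply: (mulxI x); apply: (mulxI y); rewrite -!(L_def y x) Lxy.
Qed.

End Conditions.

(** * The subloop of points fixed by [T c o T c] *)

Section Subloop.
Context (Q : aloop) (c : Q).
Local Notation e := (@one Q).
Let P (z : Q) := T c (T c z) = z.

Lemma fix_mul z w : P z -> P w -> P (z * w).
Proof. by rewrite /P -!TM => -> ->. Qed.

Lemma fix_ldiv z w : P z -> P w -> P (z \ w).
Proof. by rewrite /P -!Tldiv => -> ->. Qed.

Lemma fix_rdiv z w : P z -> P w -> P (z / w).
Proof.
by rewrite /P => Pz Pw; apply: (mulIx w); rewrite -[X in _ * X = _]Pw !TM divxK.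
Qed.

Lemma fix_one : P e.
Proof. by rewrite /P !Tx1. Qed.

Lemma fix_eq (u v : {z : Q | P z}) : proj1_sig u = proj1_sig v -> u = v.
Proof.
case: u v => [u Pu] [v Pv] /= uv; rewrite -uv in Pv *.
by rewrite (proof_irrelevance _ Pu Pv).
Qed.

(** Ends with [Defined] so that operations and inner maps of the subloop reduce to those of [Q], as
    [fix_aloop_square] requires. *)
Definition fix_aloop : aloop.
Proof.
pose m (u v : {z : Q | P z}) : {z : Q | P z} :=
  exist P _ (fix_mul _ _ (proj2_sig u) (proj2_sig v)).
pose l (u v : {z : Q | P z}) : {z : Q | P z} :=
  exist P _ (fix_ldiv _ _ (proj2_sig u) (proj2_sig v)).
pose r (u v : {z : Q | P z}) : {z : Q | P z} :=
  exist P _ (fix_rdiv _ _ (proj2_sig u) (proj2_sig v)).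
apply: (Aloop {z : Q | P z} m l r (exist P _ fix_one)) => *; apply: fix_eq => /=.
- exact: mul1x.
- exact: mulx1.
- exact: mulKx.
- exact: mulVKx.
- exact: mulxK.
- exact: divxK.
- exact: conj_map_mul.
- exact: left_map_mul.
- exact: right_map_mul.
Defined.

Lemma fix_aloop_square z : P z -> c * c * z = z * (c * c).
Proof.
move=> Pz; have Pc : P c by rewrite /P !Txx.
pose c' : fix_aloop := exist P c Pc; pose z' : fix_aloop := exist P z Pz.
(* Inside the subloop, the involution hypothesis is membership itself. *)
have c'K (u : fix_aloop) : T c' (T c' u) = u.
  by apply: fix_eq; exact: (proj2_sig u).
exact: (f_equal (@proj1_sig Q P) (square_central c' c'K z')).
Qed.

End Subloop.

(** * From automorphic loops to [aloop], and the equivalence *)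

Lemma aloop_of_automorphic (A : Type) (op : A -> A -> A) (u : A) :
  is_loop op u -> automorphic op u ->
  exists Q : aloop, exists f : A -> Q, exists g : Q -> A,
    (forall x, g (f x) = x) /\ forall x y, f (op x y) = f x * f y.
Proof.
move=> [hl [hr h1]] aut.
have cl a b : {z | op a z = b}.
  by apply: constructive_indefinite_description; have [z []] := hl a b; exists z.
have cr a b : {z | op z a = b}.
  by apply: constructive_indefinite_description; have [z []] := hr a b; exists z.
(* Divisions are chosen solutions; [r a b] solves [op z b = a], hence the swapped arguments. *)
pose l a b := proj1_sig (cl a b); pose r a b := proj1_sig (cr b a).
have opl a b : op a (l a b) = b by exact: proj2_sig (cl a b).
have opr a b : op (r a b) b = a by exact: proj2_sig (cr b a).
have lop a b : l a (op a b) = b.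
  have [z [_ hz]] := hl a (op a b).
  by rewrite -(hz _ (opl a (op a b))) (hz b).
have rop a b : r (op a b) b = a.
  have [z [_ hz]] := hr b (op a b).
  by rewrite -(hz _ (opr (op a b) b)) (hz a).
have h1x x : op u x = x by case: (h1 x).
have hx1 x : op x u = x by case: (h1 x).
(* Each standard inner map is an inverse translation after one or two translations and fixes [u], so
   automorphy applies. *)
have TA x y z :
    conj_map op r x (op y z) = op (conj_map op r x y) (conj_map op r x z).
  apply: aut; split; last by rewrite /conj_map hx1 -{1}(h1x x) rop.
  by apply: (mlt_Rinv op x (fun v => r v x)) => //; apply/mlt_L/mlt_id.
have LA x y z w : left_map op l x y (op z w) =
    op (left_map op l x y z) (left_map op l x y w).
  apply: aut; split; last by rewrite /left_map hx1 -{2}(hx1 (op x y)) lop.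
  apply: (mlt_Linv op (op x y) (fun v => l (op x y) v)) => //.
  exact/mlt_L/mlt_L/mlt_id.
have RA x y z w : right_map op r x y (op z w) =
    op (right_map op r x y z) (right_map op r x y w).
  apply: aut; split; last by rewrite /right_map h1x -{1}(h1x (op x y)) rop.
  apply: (mlt_Rinv op (op x y) (fun v => r v (op x y))) => //.
  exact/mlt_R/mlt_R/mlt_id.
by exists (Aloop A op l r u h1x hx1 lop opl rop opr TA LA RA), id, id.
Qed.

Theorem theorem3p1 (T : Type) (mul : T -> T -> T) (e : T)
  (Hloop : is_loop mul e) (Haut : automorphic mul e) (x y : T) :
  mul x (mul x y) = mul (mul y x) x <-> mul (mul x x) y = mul y (mul x x).
Proof.
have [Q [f [g [fK fM]]]] := aloop_of_automorphic T mul e Hloop Haut.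
have fI a b : f a = f b -> a = b by move=> h; rewrite -(fK a) h fK.
have E : f x * (f x * f y) = f y * f x * f x <->
    f x * f x * f y = f y * (f x * f x).
  (* The left condition places [f y] in the subloop fixed by [T (f x) o T (f x)], where the square
     of [f x] is central. *)
  split=> h; first by apply: fix_aloop_square; apply/conj_involutionE.
  exact/conj_involutionE/square_commutes_conj.
by split=> h; apply: fI; rewrite !fM; apply/E; rewrite -!fM h.
Qed.
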